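(* Let $d\ge2$, $X=\{0,\dots,d-1\}$, and let $G\le\mathrm{Aut}(X^* )$ be self-similar and level-transitive. Suppose either (1) $d$ is prime, or (2) $G$ is recurrent and acts doubly transitively on $X$. Then $$\mu(\{g\in G_\infty: g\text{ fixes infinitely many ends of }X^*\})=0.$$
   Context: $X^*$ is the rooted tree of finite words over $X$ ($vx$ joined to $v$), $X^n$ the words of length $n$, ends are infinite words; $\mathrm{Aut}(X^* )$ acts on ends. Restriction $g|_v$: $g(vw)=g(v)g|_v(w)$. $G$ is level-transitive if it acts transitively on each $X^n$; self-similar if $g|_v\in G$ for all $g\in G,v\in X^*$; recurrent if self-similar, transitive on $X$, and for each $x\in X$ the map $\{g\in G:g(x)=x\}\to G$, $g\mapsto g|_x$, is surjective. $G_n$ is the image of $G$ in $\mathrm{Aut}(X^n)$, $G_\infty=\varprojlim G_n$ (acting on the ends), and $\mu$ is the normalized Haar measure on $G_\infty$. *)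

(* Defs.v *)
From HB Require Import structures.
From mathcomp Require Import all_boot all_order all_fingroup all_algebra.
From mathcomp Require Import all_classical all_reals all_analysis.

Set Implicit Arguments.
Unset Strict Implicit.
Unset Printing Implicit Defensive.

Local Open Scope classical_set_scope.

Section TreeAut.
Variable d : nat.
Implicit Types u v w : seq 'I_d.

(* The tree X^* : vertices are the finite words, vx is joined to v. *)
Definition tree_adj u v : Prop :=
  exists x, v = rcons u x \/ u = rcons v x.

Record treeAut := TreeAut {
  taut :> seq 'I_d -> seq 'I_d;
  taut_bij : bijective taut;
  taut_root : taut [::] = [::];
  taut_adj : forall u v, tree_adj u v <-> tree_adj (taut u) (taut v) }.

HB.instance Definition _ := gen_eqMixin treeAut.
HB.instance Definition _ := gen_choiceMixin treeAut.

Implicit Types g h : treeAut.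

Lemma taut_inj g : injective g. Proof. exact: bij_inj (taut_bij g). Qed.

Lemma treeAut_eq g h : taut g =1 taut h -> g = h.
Proof.
case: g => g gb gr ga; case: h => h hb hr ha /= /funext gh.
by move: gb gr ga; rewrite gh => gb gr ga; congr TreeAut; exact: Prop_irrelevance.
Qed.

Lemma taut_rcons g v x : exists y, g (rcons v x) = rcons (g v) y.
Proof.
elim/last_ind: v x => [|v z IH] x.
  have /(taut_adj g) [y []] : tree_adj [::] (rcons [::] x) by exists x; left.
    by move=> ->; exists y.
  by rewrite taut_root => /(congr1 size); rewrite size_rcons.
have /(taut_adj g) [y []] : tree_adj (rcons v z) (rcons (rcons v z) x).
- by exists x; left.
- by move=> ->; exists y.
have [t ->] := IH z => /rcons_inj [/taut_inj /(congr1 size)].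
by rewrite !size_rcons => /eqP; rewrite -addn2 -[X in X == _]addn0 eqn_add2l.
Qed.

Lemma taut_size g v : size (g v) = size v.
Proof.
elim/last_ind: v => [|v x IH]; first by rewrite taut_root.
by have [y ->] := taut_rcons g v x; rewrite !size_rcons IH.
Qed.

Lemma taut_prefix g v w : prefix (g v) (g (v ++ w)).
Proof.
elim/last_ind: w => [|w x IH]; first by rewrite cats0 prefix_refl.
rewrite -rcons_cat; have [y ->] := taut_rcons g (v ++ w) x.
by rewrite -cats1; exact: prefix_trans IH (prefix_prefix _ _).
Qed.

Definition restr_fun g v w : seq 'I_d := drop (size v) (g (v ++ w)).

Lemma restr_funE g v w : g (v ++ w) = g v ++ restr_fun g v w.
Proof.
have /prefixP [t e] := taut_prefix g v w.
by rewrite /restr_fun e -(taut_size g v) drop_size_cat.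
Qed.

Lemma tree_adj_cat v u w : tree_adj u w <-> tree_adj (v ++ u) (v ++ w).
Proof.
split=> -[x [] e]; exists x; [left|right|left|right].
- by rewrite e rcons_cat.
- by rewrite e rcons_cat.
- by move: e; rewrite rcons_cat => /eqP; rewrite eqseq_cat // eqxx /= => /eqP.
- by move: e; rewrite rcons_cat => /eqP; rewrite eqseq_cat // eqxx /= => /eqP.
Qed.

Lemma restr_bij g v : bijective (restr_fun g v).
Proof.
have [f fK gK] := taut_bij g.
have fsz t : size (f t) = size t by rewrite -[in RHS](gK t) taut_size.
exists (fun w => drop (size v) (f (g v ++ w))) => w.
  by rewrite -restr_funE fK drop_size_cat.
set t := f (g v ++ w).
have gt : g t = g v ++ w by exact: gK.
have szv : size (take (size v) t) = size v.
  by rewrite size_takel // -(taut_size g t) gt size_cat taut_size leq_addr.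
have E : g (take (size v) t) ++ restr_fun g (take (size v) t) (drop (size v) t)
    = g v ++ w.
  by rewrite -restr_funE cat_take_drop.
move/eqP: E; rewrite eqseq_cat ?taut_size // => /andP[/eqP/taut_inj tv /eqP].
by rewrite tv.
Qed.

Lemma restr_root g v : restr_fun g v [::] = [::].
Proof. by rewrite /restr_fun cats0 -(taut_size g) drop_size. Qed.

Lemma restr_adj g v u w :
  tree_adj u w <-> tree_adj (restr_fun g v u) (restr_fun g v w).
Proof.
rewrite (tree_adj_cat v) (taut_adj g) !restr_funE.
by apply: iff_sym; exact: tree_adj_cat.
Qed.

(* g|_v, characterised by g (v ++ w) = g v ++ restr g v w (restr_funE). *)
Definition restr g v : treeAut :=
  TreeAut (restr_bij g v) (restr_root g v) (restr_adj g v).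

Definition taut_one : treeAut :=
  @TreeAut id (Bijective (fun _ => erefl) (fun _ => erefl)) erefl
    (fun u v => iff_refl _).

Definition taut_mul g h : treeAut.
Proof.
refine (@TreeAut (g \o h) (bij_comp (taut_bij g) (taut_bij h)) _ _).
- by rewrite /= !taut_root.
- by move=> u v; rewrite (taut_adj h) (taut_adj g).
Defined.

Lemma taut_inv_ex g : exists f, cancel g f /\ cancel f g.
Proof. by have [f ? ?] := taut_bij g; exists f. Qed.

Definition taut_invf g := projT1 (cid (taut_inv_ex g)).

Lemma taut_invK g : cancel g (taut_invf g).
Proof. exact: (projT2 (cid (taut_inv_ex g))).1. Qed.

Lemma taut_invKV g : cancel (taut_invf g) g.
Proof. exact: (projT2 (cid (taut_inv_ex g))).2. Qed.

Definition taut_inv g : treeAut.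
Proof.
refine (@TreeAut (taut_invf g) (Bijective (@taut_invKV g) (@taut_invK g)) _ _).
- by rewrite -[X in taut_invf g X](taut_root g) taut_invK.
- by move=> u v; rewrite (taut_adj g (taut_invf g u)) !taut_invKV.
Defined.

Lemma taut_mulA : associative taut_mul.
Proof. by move=> f g h; apply: treeAut_eq. Qed.
Lemma taut_mul1 : left_id taut_one taut_mul.
Proof. by move=> g; apply: treeAut_eq. Qed.
Lemma taut_mulr1 : right_id taut_one taut_mul.
Proof. by move=> g; apply: treeAut_eq. Qed.
Lemma taut_mulV : left_inverse taut_one taut_inv taut_mul.
Proof. by move=> g; apply: treeAut_eq => w; exact: taut_invK. Qed.
Lemma taut_mulrV : right_inverse taut_one taut_inv taut_mul.
Proof. by move=> g; apply: treeAut_eq => w; exact: taut_invKV. Qed.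

HB.instance Definition _ := isGroup.Build treeAut
  taut_mulA taut_mul1 taut_mulr1 taut_mulV taut_mulrV.

Lemma level_size n g (w : n.-tuple 'I_d) : size (g w) == n.
Proof. by rewrite taut_size size_tuple. Qed.

Lemma level_inj n g : injective (fun w : n.-tuple 'I_d => Tuple (level_size g w)).
Proof. by move=> u w [/taut_inj] /val_inj. Qed.

Definition level n g : {perm n.-tuple 'I_d} := perm (@level_inj n g).

Lemma levelE n g (w : n.-tuple 'I_d) : tval (level n g w) = g w.
Proof. by rewrite permE. Qed.

End TreeAut.

(* A subgroup of Aut(X^* ) is an element of groupClosed (treeAut d). *)
Section Subgroup.
Variables (d : nat) (G : groupClosed (treeAut d)).

Definition self_similar : Prop :=
  forall g v, g \in G -> restr g v \in G.

Definition level_transitive : Prop :=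
  forall n (u v : n.-tuple 'I_d), exists2 g, g \in G & g u = v :> seq 'I_d.

Definition transitive_on_X : Prop :=
  forall x y : 'I_d, exists2 g, g \in G & g [:: x] = [:: y].

Definition doubly_transitive_on_X : Prop :=
  forall x1 x2 y1 y2 : 'I_d, x1 <> x2 -> y1 <> y2 ->
  exists2 g, g \in G & g [:: x1] = [:: y1] /\ g [:: x2] = [:: y2].

Definition recurrent : Prop :=
  [/\ self_similar, transitive_on_X &
   forall (x : 'I_d) (h : treeAut d), h \in G ->
   exists g, [/\ g \in G, g [:: x] = [:: x] & restr g [:: x] = h]].

(* G_n; an automorphism of the first n levels of the tree is determined by its
   action on X^n. *)
Definition level_group n : set {perm n.-tuple 'I_d} :=
  [set level n g | g in [set g | g \in G]].
Arguments level_group : clear implicits.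

(* The inverse limit of the G_n inside the product of the discrete groups
   Sym(X^n); the transition map G_n -> G_m is restriction to prefixes of
   length m. *)
Definition Ginf_set :
    set (prod_topology (fun n => discrete_topology {perm n.-tuple 'I_d})) :=
  [set s | (forall n, level_group n (s n)) /\
     (forall m n (w : m.-tuple 'I_d) (u : n.-tuple 'I_d),
        prefix w u -> prefix ((s m : {perm _}) w) ((s n : {perm _}) u))].

Definition Ginf : Type := set_type Ginf_set.

HB.instance Definition _ := Topological.on Ginf.

Implicit Types s t : Ginf.

Definition Ginf_level s n : {perm n.-tuple 'I_d} := val s n.

Lemma Ginf_eq s t : (forall n, Ginf_level s n = Ginf_level t n) -> s = t.
Proof.
move=> st; apply: val_inj; apply: functional_extensionality_dep => n.
exact: st.
Qed.

Lemma Ginf_levelP s n : exists2 g, g \in G & Ginf_level s n = level n g.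
Proof. by have [/(_ n) [g gG e] _] := set_mem (valP s); exists g. Qed.

Lemma Ginf_prefix s m n (w : m.-tuple 'I_d) (u : n.-tuple 'I_d) :
  prefix w u -> prefix (Ginf_level s m w) (Ginf_level s n u).
Proof. by have [_] := set_mem (valP s); apply. Qed.

Lemma Ginf_one_subproof :
  (fun n => 1%g : {perm n.-tuple 'I_d}) \in Ginf_set.
Proof.
apply/mem_set; split=> [n|m n w u]; last by rewrite !perm1.
exists 1%g; first exact: gpred1.
by apply/permP => w; apply: val_inj; rewrite /= levelE perm1.
Qed.

Definition Ginf_one : Ginf := SigSub Ginf_one_subproof.

(* In perm.v, a * b is "first a, then b", hence the order of the factors. *)
Lemma Ginf_mul_subproof s t :
  (fun n => (Ginf_level t n * Ginf_level s n)%g) \in Ginf_set.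
Proof.
apply/mem_set; split=> [n|m n w u wu]; last first.
  by rewrite !permM; do 2!apply: Ginf_prefix.
have [g gG ->] := Ginf_levelP s n; have [h hG ->] := Ginf_levelP t n.
exists (g * h)%g; first exact: gpredM.
by apply/permP => w; apply: val_inj; rewrite permM /= !levelE.
Qed.

Definition Ginf_mul s t : Ginf := SigSub (Ginf_mul_subproof s t).

Lemma Ginf_inv_subproof s : (fun n => (Ginf_level s n)^-1%g) \in Ginf_set.
Proof.
apply/mem_set; split=> [n|m n w u wu].
  have [g gG ->] := Ginf_levelP s n.
  exists (g^-1)%g; first by rewrite /= gpredV.
  apply/permP => w; apply: (@perm_inj _ (level n g)); rewrite permKV.
  by apply: val_inj; rewrite /= !levelE; exact: taut_invKV.
set a := (Ginf_level s n)^-1%g u.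
have mn : m <= size a by rewrite size_tuple -(size_tuple w) -(size_tuple u) size_prefix.
have sz : size (take m a) == m by rewrite size_takel.
have : prefix (Ginf_level s m (Tuple sz)) (Ginf_level s n a).
  exact/Ginf_prefix/prefix_take.
rewrite permKV => au.
have -> : w = Ginf_level s m (Tuple sz).
  apply: val_inj; move: wu au; rewrite !prefixE !size_tuple => /eqP wu /eqP.
  by rewrite wu.
by rewrite permK prefix_take.
Qed.

Definition Ginf_inv s : Ginf := SigSub (Ginf_inv_subproof s).

Lemma Ginf_mulA : associative Ginf_mul.
Proof. by move=> s t r; apply: Ginf_eq => n; exact/esym/mulgA. Qed.
Lemma Ginf_mul1 : left_id Ginf_one Ginf_mul.
Proof. by move=> s; apply: Ginf_eq => n; exact: mulg1. Qed.
Lemma Ginf_mulr1 : right_id Ginf_one Ginf_mul.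
Proof. by move=> s; apply: Ginf_eq => n; exact: mul1g. Qed.
Lemma Ginf_mulV : left_inverse Ginf_one Ginf_inv Ginf_mul.
Proof. by move=> s; apply: Ginf_eq => n; exact: mulgV. Qed.
Lemma Ginf_mulrV : right_inverse Ginf_one Ginf_inv Ginf_mul.
Proof. by move=> s; apply: Ginf_eq => n; exact: mulVg. Qed.

HB.instance Definition _ := isGroup.Build Ginf
  Ginf_mulA Ginf_mul1 Ginf_mulr1 Ginf_mulV Ginf_mulrV.
HB.instance Definition _ := isPointed.Build Ginf 1%g.

Definition Ginf_borel := g_sigma_algebraType (@open Ginf).

(* The ends of the tree are the infinite words e : nat -> 'I_d; end_actP below
   characterises the action of G_infty on them. *)
Definition end_prefix (e : nat -> 'I_d) n : n.-tuple 'I_d :=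
  [tuple e i | i < n].

Definition end_act s (e : nat -> 'I_d) : nat -> 'I_d :=
  fun n => tnth (Ginf_level s n.+1 (end_prefix e n.+1)) ord_max.

Lemma end_actP s e n :
  end_prefix (end_act s e) n = Ginf_level s n (end_prefix e n).
Proof.
apply: eq_from_tnth => i; rewrite tnth_mktuple /end_act.
have pre : prefix (end_prefix e i.+1) (end_prefix e n).
  rewrite prefixE size_tuple; apply/eqP/(@eq_from_nth _ (e 0)).
    by rewrite size_takel size_tuple.
  rewrite size_takel ?size_tuple // => j ji.
  rewrite nth_take // -[j]/(val (Ordinal ji)) -tnth_nth tnth_mktuple.
  have jn : j < n by exact: leq_trans ji (ltn_ord i).
  by rewrite -[val _]/(val (Ordinal jn)) -tnth_nth tnth_mktuple.
have := Ginf_prefix s pre; rewrite prefixE size_tuple => /eqP h.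
by rewrite !(tnth_nth (e 0)) /= -h nth_take.
Qed.

Definition fixes_inf_many_ends : set Ginf_borel :=
  [set s : Ginf | infinite_set [set e | end_act s e = e]].

End Subgroup.

(* A probability measure on the Borel sets of the compact metrizable group
   G_infty is automatically regular, so left invariance makes it the normalized
   Haar measure. *)
Definition is_haar (R : realType) (d : nat) (G : groupClosed (treeAut d))
    (mu : probability (Ginf_borel G) R) : Prop :=
  forall (g : Ginf G) (A : set (Ginf_borel G)), measurable A ->
    mu [set (g * x)%g | x in (A : set (Ginf G))] = mu A.

(* Main.v *)
Require Import Defs.
From HB Require Import structures.
From mathcomp Require Import all_boot all_order all_fingroup all_algebra.
From mathcomp Require Import all_classical all_reals all_analysis.
From mathcomp Require Import measurable_realfun.
Import Order.TTheory GRing.Theory Num.Theory.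

Local Open Scope classical_set_scope.

(** Left invariance and level-transitivity make the probability that a random
    element of G_infty maps [u] to [v] the same for all words [v] of the length
    of [u], so a random element fixes on average exactly one word of each
    length [n], and by Markov's inequality it fixes at least [k] of them with
    probability at most [1/k]. An element fixing infinitely many ends fixes, for
    every [k], at least [k] words of each sufficiently large length; these
    events increase to one of probability at most [1/k]. For measurability,
    Koenig's lemma shows that a word is a prefix of a fixed end as soon as it
    is a prefix of fixed words of all lengths. *)

(** * Infinite words through prefix-closed sets of finite words *)

Lemma konig (T : finType) (P : seq T -> Prop) (v : seq T) :
  (forall u w, prefix u w -> P w -> P u) ->
  (forall n, size v <= n -> exists w, [/\ size w = n, prefix v w & P w]) ->
  exists2 e : nat -> T, forall n, P (mkseq e n) & mkseq e (size v) = v.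
Proof.
move=> Pprefix.
pose I u := forall n, size u <= n -> exists w, [/\ size w = n, prefix u w & P w].
rewrite -/(I v) => Iv.
have [x0 _] : exists x : T, True.
  by have [[|x w] [sw _ _]] := Iv (size v).+1 (leqnSn _); [|exists x].
(* If every child [rcons u x] missed some length [m x], an extension of [u] at least as long as all
   the [m x] would pass through one of the children and, cut at length [m x], contradict the choice
   of [m x]. The implication sits under the existential so that choice gives a total function; [x0]
   serves the words outside [I]. *)
have step u : exists x, I u -> I (rcons u x).
  have [Iu|nIu] := pselect (I u); last by exists x0.
  apply: contrapT => /forallNP nI.
  have {nI} /choice [m mP] : forall x, exists m, size u < m /\
      forall w, ~ [/\ size w = m, prefix (rcons u x) w & P w].
    move=> x; apply: contrapT => /forallNP nm; apply: (nI x) => _ n.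
    rewrite size_rcons => un; apply: contrapT => /forallNP nw.
    by apply: (nm n).
  have [|w [sw uw Pw]] := Iu (maxn (size u).+1 (\max_x m x)).
    by rewrite leq_max leqnSn.
  case/prefixP: uw => -[|x t] wE.
    have : size u < size w by rewrite sw leq_max leqnn.
    by rewrite wE cats0 ltnn.
  have [um /(_ (take (m x) w))] := mP x; apply.
  have mw : m x <= size w.
    by rewrite sw leq_max; apply/orP; right; apply: (leq_bigmax x).
  split; first by rewrite size_takel.
  - rewrite wE -cat_rcons take_cat size_rcons.
    by rewrite ltnNge um; exact: prefix_prefix.
  - by apply: Pprefix Pw; exact: prefix_take.
have /choice [f fP] := step.
pose u k := iter k (fun s => rcons s (f s)) v.
have Iuk k : I (u k) by elim: k => [//|k IH]; exact: fP.
have size_u k : size (u k) = size v + k.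
  by elim: k => [|k IH]; rewrite ?addn0 // size_rcons IH addnS.
have u_prefix i j : prefix (u i) (u (i + j)).
  elim: j => [|j IH]; first by rewrite addn0 prefix_refl.
  by rewrite addnS /= -cats1; apply: prefix_trans IH (prefix_prefix _ _).
(* The word [u n.+1] has more than [n] letters, so the default [x0] is never read. *)
pose e n := nth x0 (u n.+1) n.
have eE n : mkseq e n = take n (u n).
  apply: (@eq_from_nth _ x0).
    by rewrite size_mkseq size_takel // size_u leq_addl.
  rewrite size_mkseq => i lt_in; rewrite nth_mkseq // nth_take // /e.
  have /prefixP [t] := u_prefix i.+1 (n - i.+1).
  by rewrite subnKC // => ->; rewrite nth_cat size_u addnS ltnS leq_addl.
exists e.
  move=> n; have [w [sw uw Pw]] := Iuk n _ (leqnn _).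
  rewrite eE; apply: Pprefix Pw.
  exact: prefix_trans (prefix_take _ _) uw.
rewrite eE.
have := u_prefix 0 (size v); rewrite add0n prefixE => /eqP.
by rewrite -[in X in take X _](addn0 (size v)) -(size_u 0).
Qed.

(** * Fixed ends, their prefixes, and measurability of the event *)

Section FixedEnds.
Context {d : nat} {G : groupClosed (treeAut d)}.
Implicit Types (s : Ginf G) (e : nat -> 'I_d).

Lemma tval_end_prefix e n : end_prefix e n = mkseq e n :> seq 'I_d.
Proof. by rewrite /= /mkseq -val_enum_ord -map_comp. Qed.

Lemma end_act_fixP s e :
  end_act s e = e <->
  forall n, Ginf_level s n (end_prefix e n) = end_prefix e n.
Proof.
split=> [fix_e n|fix_e]; first by rewrite -end_actP fix_e.
by apply/funext => n; rewrite /end_act fix_e tnth_mktuple.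
Qed.

(* Quantifying over tuples with underlying word [w] avoids casts between levels
   whose lengths are only provably equal. *)
Definition fixes_word s (w : seq 'I_d) : Prop :=
  forall n (t : n.-tuple 'I_d), t = w :> seq _ -> Ginf_level s n t = t.

Lemma fixes_wordP s n (t : n.-tuple 'I_d) :
  fixes_word s t <-> Ginf_level s n t = t.
Proof.
split=> [|fix_t m r rt]; first exact.
have mn : m = n by rewrite -(size_tuple r) rt size_tuple.
by subst m; rewrite (val_inj rt : r = t).
Qed.

Lemma fixes_word_prefix s u w : prefix u w -> fixes_word s w -> fixes_word s u.
Proof.
move=> + fix_w n t tu; rewrite -tu => tw; apply: val_inj.
have := Ginf_prefix s (tw : prefix t (in_tuple w)).
rewrite (fix_w _ (in_tuple w) erefl) /=; move: tw.
by rewrite !prefixE !size_tuple => /eqP -> /eqP ->.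
Qed.

(** Koenig's lemma applies because [s] preserves prefixes, which makes the set of fixed words
    prefix-closed. *)
Lemma fixed_end_through s n (v : n.-tuple 'I_d) :
  (forall m, n <= m -> exists2 w : m.-tuple 'I_d, prefix v w &
     Ginf_level s m w = w) ->
  exists2 e, end_act s e = e & end_prefix e n = v.
Proof.
move=> ext_v; have [||e fix_e ev] := @konig _ (fixes_word s) v.
- exact: fixes_word_prefix.
- move=> m; rewrite size_tuple => /ext_v [w vw /fixes_wordP fix_w].
  by exists w; rewrite size_tuple.
exists e; last first.
  by apply/val_inj/(etrans (tval_end_prefix e n)); rewrite -[RHS]ev size_tuple.
apply/end_act_fixP => m; apply/fixes_wordP; rewrite tval_end_prefix.
exact: fix_e.
Qed.

Lemma end_prefix_prefix e m n : m <= n -> prefix (end_prefix e m) (end_prefix e n).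
Proof.
move=> mn; rewrite !tval_end_prefix prefixE size_mkseq /mkseq.
by rewrite -map_take take_iota (minn_idPl mn).
Qed.

(** Two distinct ends differ at some position, and finitely many pairs admit a common bound on these
    positions. *)
Lemma separate_ends (I : finType) (h : I -> nat -> 'I_d) : injective h ->
  exists N, forall n, N <= n -> injective (fun i => end_prefix (h i) n).
Proof.
move=> h_inj.
have /choice [p pP] : forall ij : I * I,
    exists p, ij.1 != ij.2 -> h ij.1 p != h ij.2 p.
  move=> [i j] /=; apply: contrapT => /forallNP np.
  have /h_inj ij : h i = h j; last by apply: (np 0); rewrite ij eqxx.
  apply/funext => q; apply: contrapT => /eqP hq.
  by apply: (np q).
(* A prefix shows position [p] only if its length exceeds [p], hence the successor. *)
exists (\max_ij (p ij).+1) => n le_n i j /= eij.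
apply/eqP; apply: contrapT => /negP nij.
have pn : p (i, j) < n.
  by apply: leq_trans le_n; exact: (leq_bigmax (F := fun ij => (p ij).+1) (i, j)).
have /negP[] := pP (i, j) nij; apply/eqP.
have := congr1 (fun t => tnth t (Ordinal pn)) eij.
by rewrite !tnth_mktuple.
Qed.

Lemma inf_many_ends_prefixes s k : fixes_inf_many_ends s ->
  exists N, forall n, N <= n -> exists h : 'I_k -> nat -> 'I_d,
    (forall i, end_act s (h i) = h i) /\
    injective (fun i => end_prefix (h i) n).
Proof.
move=> inf; have [e0 _] := infinite_setN0 inf.
have [B BA le_kB] := infinite_set_fset k inf.
pose h (i : 'I_k) := nth e0 (finmap.enum_fset B) i.
have lt_iB (i : 'I_k) : i < size (finmap.enum_fset B) by exact: leq_trans (ltn_ord i) le_kB.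
have [|N NP] := @separate_ends _ h.
  by move=> i j /eqP; rewrite nth_uniq ?finmap.fset_uniq // => /eqP/val_inj.
exists N => n Nn; exists h; split; last exact: NP.
by move=> i; apply: BA; exact: mem_nth.
Qed.

(** This form serves measurability: quantification over ends is replaced by countable quantifiers
    over [k], [N], [A] and [m], and the innermost condition depends on level [m] of [s] only. *)
Lemma fixes_inf_many_endsP s : fixes_inf_many_ends s <->
  forall k, exists N (A : {set N.-tuple 'I_d}), forall m,
    k <= #|A| /\ forall v, v \in A -> N <= m ->
      exists2 w : m.-tuple 'I_d, prefix v w & Ginf_level s m w = w.
Proof.
split=> [inf k|many].
  have [N /(_ N (leqnn N)) [h [fix_h h_inj]]] := inf_many_ends_prefixes s k inf.
  exists N, [set end_prefix (h i) N | i : 'I_k]%SET => m; split.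
    by rewrite card_imset // card_ord.
  move=> v /imsetP [i _ ->] Nm; exists (end_prefix (h i) m).
    exact: end_prefix_prefix.
  by have /end_act_fixP := fix_h i; apply.
(* If [r] listed all fixed ends, each word of [A] would be the prefix of an end in [r], so [A] could
   not have more than [size r] elements. *)
move=> /finite_seqP [r rE].
have [N [A AP]] := many (size r).+1.
have [le_rA _] := AP 0; move: le_rA; apply/negP; rewrite -leqNgt.
rewrite -(size_map (fun e => end_prefix e N)); apply: leq_trans (card_size _).
apply/subset_leq_card/fintype.subsetP => v vA.
have [|e fix_e <-] := @fixed_end_through s N v.
  by move=> m Nm; exact: (AP m).2.
apply/mapP; exists e => //.
by have : [set e | end_act s e = e] e by []; rewrite rE.
Qed.

(** The event is open: it is the preimage of a subset of a discrete space under a continuous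
    projection. *)
Lemma measurable_level n (Q : {perm n.-tuple 'I_d} -> Prop) :
  measurable ([set s : Ginf G | Q (Ginf_level s n)] : set (Ginf_borel G)).
Proof.
apply: sub_sigma_algebra.
have cts : continuous (fun s : Ginf G =>
    (Ginf_level s n : discrete_topology {perm n.-tuple 'I_d})).
  move=> s; apply: (@continuous_comp _ _ _ (set_val : Ginf G -> _) (proj n)).
    exact: initial_continuous.
  exact: proj_continuous.
move/continuousP: cts; apply; exact: discrete_open.
Qed.

Lemma measurable_fixes_inf_many_ends : measurable (@fixes_inf_many_ends d G).
Proof.
have -> : @fixes_inf_many_ends d G =
    \bigcap_k \bigcup_N \bigcup_(A : {set N.-tuple 'I_d}) \bigcap_m
      [set s : Ginf G | k <= #|A| /\ forall v, v \in A -> N <= m ->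
        exists2 w : m.-tuple 'I_d, prefix v w & Ginf_level s m w = w].
  apply/seteqP; split => s.
    move=> /fixes_inf_many_endsP many k _.
    have [N [A AP]] := many k.
    by exists N => //; exists A => // m _; exact: AP.
  move=> many; apply/fixes_inf_many_endsP => k.
  have [N _ [A _ AP]] := many k I.
  by exists N, A => m; exact: AP.
apply: bigcapT_measurable => k; apply: bigcupT_measurable => N.
apply: countable_bigcupT_measurable => [|A]; first exact: countableP.
apply: bigcapT_measurable => m.
exact: (measurable_level m (fun p => k <= #|A| /\ forall v, v \in A -> N <= m ->
        exists2 w : m.-tuple 'I_d, prefix v w & p w = w)).
Qed.

End FixedEnds.

(** * Markov's inequality for the number of events that occur *)

Section Counting.
Local Open Scope ring_scope.
Local Open Scope ereal_scope.
Context {disp : measure_display} {T : measurableType disp} {R : realType}.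
Context {I : finType}.
Variables (mu : {measure set T -> \bar R}) (A : I -> set T).
Hypothesis mA : forall i, measurable (A i).

Lemma measurable_sum_indic :
  measurable_fun setT (fun x => \sum_i (\1_(A i) x : R)%:E).
Proof.
by apply: emeasurable_sum => i; apply/measurable_EFinP; exact: measurable_indic.
Qed.

Lemma integral_sum_indic :
  \int[mu]_x (\sum_i (\1_(A i) x)%:E) = \sum_i mu (A i).
Proof.
rewrite ge0_integral_sum //.
- by apply: eq_bigr => i _; rewrite integral_indic // setIT.
- by move=> i; apply/measurable_EFinP; exact: measurable_indic.
Qed.

Lemma sum_indicE x : \sum_i (\1_(A i) x)%:E = #|[set i | x \in A i]%SET|%:R%:E :> \bar R.
Proof.
rewrite sumEFin; congr EFin; rewrite -sum1_card natr_sum.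
rewrite [RHS]big_mkcond; apply: eq_bigr => i _.
by rewrite inE indicE; case: (x \in A i).
Qed.

(** The function [k] times the indicator of [B] is at most the number of the [A i] containing the
    point; integrate both. *)
Lemma markov_count (B : set T) k : measurable B ->
  (forall x, B x -> (k <= #|[set i | x \in A i]%SET|)%N) ->
  k%:R%:E * mu B <= \sum_i mu (A i).
Proof.
move=> mB Bk; rewrite -integral_sum_indic.
have -> : mu B = mu (B `&` setT) by rewrite setIT.
rewrite -integral_indic // -ge0_integralZl //; last first.
  by apply/measurable_EFinP; exact: measurable_indic.
apply: ge0_le_integral => //.
- by apply/measurable_EFinP; apply: measurable_funM => //; exact: measurable_indic.
- exact: measurable_sum_indic.
move=> x _; rewrite sum_indicE -EFinM lee_fin indicE.
by case: (boolP (x \in B)) => [/set_mem/Bk|_]; rewrite ?mulr0 // mulr1 ler_nat.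
Qed.

End Counting.

(** * Haar probabilities of moving and fixing words *)

Section Haar.
Local Open Scope ring_scope.
Local Open Scope ereal_scope.
Context {R : realType} {d : nat} {G : groupClosed (treeAut d)}.
Context {mu : probability (Ginf_borel G) R}.
Hypothesis G_trans : level_transitive G.
Hypothesis mu_haar : is_haar mu.

Lemma Ginf_of_subproof (g : treeAut d) : g \in G ->
  (fun n => level n g) \in Ginf_set G.
Proof.
move=> gG; apply/mem_set; split=> [n|m n w u wu]; first by exists g.
have /prefixP[t ut] := wu.
by rewrite !levelE ut; exact: taut_prefix.
Qed.

Definition Ginf_of (g : treeAut d) (gG : g \in G) : Ginf G :=
  SigSub (Ginf_of_subproof g gG).

Lemma Ginf_transitive n (u v : n.-tuple 'I_d) :
  exists s : Ginf G, Ginf_level s n u = v.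
Proof.
have [g gG guv] := G_trans n u v; exists (Ginf_of g gG).
by apply: val_inj; rewrite /Ginf_level /= levelE.
Qed.

Definition moves n (u v : n.-tuple 'I_d) : set (Ginf_borel G) :=
  [set s : Ginf G | Ginf_level s n u = v].

Lemma measurable_moves n (u v : n.-tuple 'I_d) : measurable (moves n u v).
Proof. exact: (measurable_level n (fun p => p u = v)). Qed.

Lemma Ginf_level_mul (s t : Ginf G) n (w : n.-tuple 'I_d) :
  Ginf_level (s * t)%g n w = Ginf_level s n (Ginf_level t n w).
Proof. by rewrite -permM. Qed.

(** Left multiplication by an element taking [v] to [w] carries the first event onto the second. *)
Lemma haar_moves n (u v w : n.-tuple 'I_d) : mu (moves n u v) = mu (moves n u w).
Proof.
have [g gvw] := Ginf_transitive n v w.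
rewrite -(mu_haar g _ (measurable_moves n u v)); congr (mu _).
apply/seteqP; split => [_ [s suv <-]|s suw].
  by rewrite /moves /= Ginf_level_mul suv.
exists (g^-1 * s)%g; last by rewrite mulgA mulgV mul1g.
apply: (@perm_inj _ (Ginf_level g n)); rewrite -Ginf_level_mul mulgA mulgV mul1g.
by rewrite suw.
Qed.

(** Every element sends [u] to exactly one word, so the indicators add up to the constant 1. *)
Lemma sum_haar_moves n (u : n.-tuple 'I_d) : \sum_v mu (moves n u v) = 1.
Proof.
rewrite -integral_sum_indic; last exact: measurable_moves.
rewrite (eq_integral (cst 1)) => [|s _].
  by rewrite integral_cst // mul1e; exact: probability_setT.
rewrite sum_indicE (_ : #|_| = 1%N) //; apply/eqP/cards1P.
exists (Ginf_level (s : Ginf G) n u); apply/setP => v; rewrite !inE.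
by apply/idP/eqP => [/set_mem <- //|->]; apply/mem_set.
Qed.

(** The sum is the expected number of fixed words. For each [v], the [N] events [moves n v w] are
    equally likely with total 1, so the one with [w = v] has probability [N^-1]. *)
Lemma sum_haar_fix n : (0 < d)%N -> \sum_v mu (moves n v v) = 1.
Proof.
move=> d_gt0; set N : R := #|{: n.-tuple 'I_d}|%:R.
have N_neq0 : N != 0%R.
  by rewrite pnatr_eq0 -lt0n card_tuple card_ord expn_gt0 d_gt0.
have mu_fix v : mu (moves n v v) = N^-1%:E.
  have := sum_haar_moves n v.
  rewrite (eq_bigr (fun=> mu (moves n v v))) => [|w _]; last exact: haar_moves.
  have mu_fin : mu (moves n v v) \is a fin_num.
    by apply: fin_num_measure; exact: measurable_moves.
  rewrite -(fineK mu_fin) sumEFin sumr_const => -[].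
  rewrite -mulr_natr => NP; congr EFin.
  by apply: (mulIf N_neq0); rewrite mulVf.
rewrite (eq_bigr (fun=> N^-1%:E)) => [|v _]; last exact: mu_fix.
by rewrite sumEFin sumr_const -mulr_natr mulVf.
Qed.

Lemma haar_many_fixed n k : (0 < d)%N ->
  k%:R%:E * mu [set s : Ginf G | (k <= #|[set v | Ginf_level s n v == v]%SET|)%N] <= 1.
Proof.
move=> d_gt0; rewrite -(sum_haar_fix n d_gt0); apply: markov_count.
- by move=> v; exact: measurable_moves.
- exact: (measurable_level n (fun p => (k <= #|[set v | p v == v]%SET|)%N)).
move=> s /= le_k; apply: leq_trans le_k _; apply/eq_leq/eq_card => v; rewrite !inE.
by apply/eqP/idP => [sv|/set_mem//]; apply/mem_set.
Qed.

Lemma haar_fixes_inf_many_ends_le k : (0 < d)%N ->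
  mu (@fixes_inf_many_ends d G) <= k.+1%:R^-1%:E.
Proof.
move=> d_gt0.
pose C n : set (Ginf_borel G) :=
  [set s : Ginf G | (k.+1 <= #|[set v | Ginf_level s n v == v]%SET|)%N].
have mC n : measurable (C n).
  exact: (measurable_level n (fun p => (k.+1 <= #|[set v | p v == v]%SET|)%N)).
(* The events [C n] need not be nested; intersecting over all levels from [N] on gives an increasing
   sequence, to which continuity of [mu] from below applies. *)
pose E N := \bigcap_(n in [set n | (N <= n)%N]) C n.
have mE N : measurable (E N) by exact: bigcap_measurableType.
have mUE : measurable (\bigcup_N E N) by exact: bigcupT_measurable.
have sub : @fixes_inf_many_ends d G `<=` \bigcup_N E N.
  move=> s inf; have [N NP] := inf_many_ends_prefixes s k.+1 inf.
  exists N => // n /= Nn; have [h [fix_h h_inj]] := NP n Nn.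
  rewrite /C /= -(card_ord k.+1) -(card_imset _ h_inj).
  apply/subset_leq_card/fintype.subsetP => _ /imsetP [i _ ->]; rewrite inE.
  by have /end_act_fixP -> := fix_h i.
apply: (@le_trans _ _ (mu (\bigcup_N E N))).
  by rewrite le_measure ?inE //; exact: measurable_fixes_inf_many_ends.
have cvgE : (mu \o E) @ \oo --> mu (\bigcup_N E N).
  apply: nondecreasing_cvg_mu => // M N MN; apply/subsetPset => s sE n Nn.
  by apply: sE; exact: leq_trans MN Nn.
apply: (cvge_to_le cvgE); apply: nearW => N /=.
apply: (@le_trans _ _ (mu (C N))).
  by rewrite le_measure ?inE // => s; apply; rewrite /= leqnn.
rewrite -[leRHS]mule1 lee_pdivlMl ?ltr0n //.
exact: haar_many_fixed.
Qed.

End Haar.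

Theorem theorem5p2 (R : realType) (d : nat) (d_ge2 : (2 <= d)%N)
    (G : groupClosed (treeAut d))
    (G_self_similar : self_similar G)
    (G_level_transitive : level_transitive G)
    (G_case : prime d \/ (recurrent G /\ doubly_transitive_on_X G))
    (mu : probability (Ginf_borel G) R) (mu_haar : is_haar mu) :
  measurable (@fixes_inf_many_ends d G) /\
  mu (@fixes_inf_many_ends d G) = 0%E.
Proof.
split; first exact: measurable_fixes_inf_many_ends.
apply/eqP; rewrite eq_le measure_ge0 andbT.
apply/lee_addgt0Pr => e e_gt0; rewrite add0e.
(* With [k] the integer part of [e^-1], [k.+1] exceeds [e^-1], so the bound [k.+1%:R^-1] is below
   [e]. *)
have := haar_fixes_inf_many_ends_le G_level_transitive mu_haar
  (Num.truncn e^-1) (ltnW d_ge2).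
move=> /le_trans; apply; rewrite lee_fin invf_ple ?posrE ?ltr0n //.
exact/ltW/truncnS_gt.
Qed.
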